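(* Let $H$ be a real Hilbert space and $C\subset H$ a nonempty closed convex subset. Let $f_1,\dots,f_N:C\times C\to\mathbb{R}$ be bifunctions satisfying (A1)–(A4), let $A_1,\dots,A_N:C\to H$ be $\alpha$-inverse strongly monotone mappings (with a common constant $\alpha>0$), and let $S_1,\dots,S_M:C\to C$ be asymptotically $\kappa$-strictly pseudocontractive mappings with a common constant $\kappa\in[0,1)$ and a common sequence $\{k_n\}\subset[1,+\infty)$, $k_n\to1$. Suppose that the set $$F=\Big(\bigcap_{i=1}^N GEP(f_i,A_i)\Big)\cap\Big(\bigcap_{j=1}^M F(S_j)\Big)$$ is nonempty and bounded, and let $\omega>0$ be such that $\|v\|\le\omega$ for all $v\in F$. Let $\{\alpha_n\},\{\beta_n\},\{r_n\}$ ($n\ge 0$) be real sequences such that (a) $0<\alpha_n<1$ and $\limsup_{n\to\infty}\alpha_n<1$; (b) $\kappa\le\beta_n\le b<1$ for some $b\in(\kappa,1)$; (c) $0<d\le r_n\le e<2\alpha$ for some constants $d,e$. Let $x_0\in C$, $C_0=C$, and for $n\ge0$ define $$y_n^i=T_{r_n}^{f_i}(x_n-r_nA_i x_n),\quad i=1,\dots,N,$$ $$i_n\in\arg\max\{\|y_n^i-x_n\|:1\le i\le N\},\quad \bar y_n=y_n^{i_n},$$ $$z_n^j=\alpha_nx_n+(1-\alpha_n)\big(\beta_n\bar y_n+(1-\beta_n)S_j^n\bar y_n\big),\quad j=1,\dots,M,$$ $$j_n\in\arg\max\{\|z_n^j-x_n\|:1\le j\le M\},\quad \bar z_n=z_n^{j_n},$$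 $$C_{n+1}=\{v\in C_n:\|\bar z_n-v\|^2\le\|x_n-v\|^2+\epsilon_n\},\quad \epsilon_n=(k_n-1)(\|x_n\|+\omega)^2,$$ $$x_{n+1}=P_{C_{n+1}}(x_0).$$ Then the sequences $\{x_n\}$, $\{y_n^i\}$ ($i=1,\dots,N$) and $\{z_n^j\}$ ($j=1,\dots,M$) converge strongly to $P_Fx_0$.
   Context: Conditions on a bifunction $f:C\times C\to\mathbb{R}$: (A1) $f(x,x)=0$ for all $x\in C$; (A2) $f(x,y)+f(y,x)\le0$ for all $x,y\in C$; (A3) $\limsup_{t\to0^+}f(tz+(1-t)x,y)\le f(x,y)$ for all $x,y,z\in C$; (A4) for each $x\in C$, $f(x,\cdot)$ is convex and lower semicontinuous. A mapping $A:C\to H$ is $\alpha$-inverse strongly monotone ($\alpha>0$) if $\langle Ax-Ay,x-y\rangle\ge\alpha\|Ax-Ay\|^2$ for all $x,y\in C$. $GEP(f,A)$ is the set of $x\in C$ with $f(x,y)+\langle Ax,y-x\rangle\ge0$ for all $y\in C$. A mapping $S:C\to C$ is asymptotically $\kappa$-strictly pseudocontractive with constant $\kappa\in[0,1)$ and sequence $\{k_n\}\subset[1,+\infty)$, $k_n\to1$, if $\|S^nx-S^ny\|^2\le k_n\|x-y\|^2+\kappa\|(I-S^n)x-(I-S^n)y\|^2$ for all $x,y\in C$, $n\ge1$. $F(S)$ is the set of fixed points of $S$. Convention: $S^0=I$, and $k_0\in[1,+\infty)$ is any number (it appears only in $\epsilon_0$). For $f$ satisfying (A1)–(A4), $r>0$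 and $x\in H$, $T_r^fx$ denotes the point $z\in C$ (which is known to exist and be unique) such that $f(z,y)+\frac1r\langle y-z,z-x\rangle\ge0$ for all $y\in C$. $P_D$ denotes the metric projection onto a nonempty closed convex set $D\subset H$. In the $\arg\max$ choices any maximizer may be taken. *)

(* Defs.v *)
From mathcomp Require Export all_boot all_order all_algebra.
From mathcomp Require Export all_classical all_reals all_analysis.
Export Order.TTheory GRing.Theory Num.Theory.
Export numFieldNormedType.Exports.

#[export] Set Implicit Arguments.
#[export] Unset Strict Implicit.
#[export] Unset Printing Implicit Defensive.

Local Open Scope classical_set_scope.
Local Open Scope ring_scope.

(* A real Hilbert space is a complete normed space H carrying a symmetric
   positive definite bilinear form whose quadratic form is the squared norm. *)
Definition inner_product_norm (R : realType) (H : completeNormedModType R)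
    (dot : {dot H for idfun}) : Prop :=
  forall v : H, dot v v = `|v| ^+ 2.

(* Maps defined on C are represented by functions defined on the whole of H,
   of which only the values at points of C are ever constrained or used. *)

(* In (A4), [subspace C] is H with the topology induced on C (the points
   outside C being isolated), so that lower semicontinuity is relative to C. *)
Record equilibrium_bifunction (R : realType) (H : completeNormedModType R)
    (C : set H) (f : H -> H -> R) : Prop := EquilibriumBifunction {
  bifun_A1 : forall x, C x -> f x x = 0 ;
  bifun_A2 : forall x y, C x -> C y -> f x y + f y x <= 0 ;
  bifun_A3 : forall x y z, C x -> C y -> C z ->
    (limf_esup (fun t : R => (f (t *: z + (1 - t) *: x) y)%:E) (0 : R)^'+
       <= (f x y)%:E)%E ;
  bifun_A4 : forall x, C x ->
    convex_function C (f x) /\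
    lower_semicontinuous (fun y : subspace C => (f x y)%:E) }.

Definition inverse_strongly_monotone (R : realType)
    (H : completeNormedModType R) (dot : {dot H for idfun}) (C : set H)
    (alpha : R) (A : H -> H) : Prop :=
  forall x y, C x -> C y ->
    alpha * `|A x - A y| ^+ 2 <= dot (A x - A y) (x - y).

Definition GEP (R : realType) (H : completeNormedModType R)
    (dot : {dot H for idfun}) (C : set H) (f : H -> H -> R) (A : H -> H) :
    set H :=
  [set x | C x /\ forall y, C y -> 0 <= f x y + dot (A x) (y - x)].

Definition asymptotically_strictly_pseudocontractive (R : realType)
    (H : completeNormedModType R) (C : set H) (kappa : R) (k : nat -> R)
    (S : H -> H) : Prop :=
  (forall x, C x -> C (S x)) /\
  forall n x y, (1 <= n)%N -> C x -> C y ->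
    `|iter n S x - iter n S y| ^+ 2 <=
      k n * `|x - y| ^+ 2 +
      kappa * `|(x - iter n S x) - (y - iter n S y)| ^+ 2.

Definition fixed_points (R : realType) (H : completeNormedModType R)
    (C : set H) (S : H -> H) : set H :=
  [set x | C x /\ S x = x].

(* [is_resolvent dot C f r x z] is the relation z = T_r^f x. *)
Definition is_resolvent (R : realType) (H : completeNormedModType R)
    (dot : {dot H for idfun}) (C : set H) (f : H -> H -> R) (r : R) (x z : H) :
    Prop :=
  C z /\ forall y, C y -> 0 <= f z y + r^-1 * dot (y - z) (z - x).

(* The point of D nearest to x; the default value x is returned only when
   there is none, which never happens if D is nonempty, closed and convex. *)
Definition metric_proj (R : realType) (H : completeNormedModType R)
    (D : set H) (x : H) : H :=
  xget x [set p | D p /\ forall q, D q -> `|x - p| <= `|x - q|].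

(* Main.v *)
Require Import Defs.
From mathcomp Require Import ring lra.

(**
The sets [Cs n] are closed, convex, decreasing and contain [F].  Closedness and
convexity hold because the inequality that cuts [Cs n.+1] out of [Cs n] defines
a closed half-space ([closed_bisector], [convex_bisector]).  That [F] is never
cut off is the conjunction of two estimates at a point v of [F]: the resolvent
step does not increase the distance to v ([resolvent_step]), and the averaged
iteration multiplies its square by at most [k n] ([asp_mann_step]), an excess
that the term [(k n - 1) * (`|x n| + omega) ^+ 2] compensates.

Each [x n] is thus the projection of x 0 on [Cs n].  The obtuse angle property
of projections shows that [`|x 0 - x n| ^+ 2] increases with n, stays bounded,
and that its increments dominate [`|x m - x n| ^+ 2]; hence x converges to some
p ([nested_projections_cvg]).  Passing to the limit in the same property, with q
in [F], gives [`|p - q| ^+ 2 <= `|x 0 - q| ^+ 2 - `|x 0 - p| ^+ 2], which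
forces p to be the one nearest point of [F] as soon as p lies in [F]
([metric_proj_eq]).

It remains to see that all sequences tend to p and that p lies in [F].  Since
[x n.+1] lies in [Cs n.+1], the farthest z tends to p, hence every z does.  The
two estimates above are kept in a quantitative form: the loss in
[asp_mann_step] controls the gap between [`|x n - v| ^+ 2] and
[`|y n i - v| ^+ 2], and this gap controls [`|y n i - x n| ^+ 2] in
[resolvent_step]; so the farthest y, hence every y, tends to p.  Solving the
definition of z for the iterate shows that [iter n (S j)] applied to the
farthest y tends to p, and p is fixed by S j because the iterates are Lipschitz
with constants converging in n ([asp_fixed_limit]).  Finally the equilibrium
inequalities pass to the limit ([resolvent_limit]): monotonicity turns them
around so that lower semicontinuity applies, and the resulting dual inequality
implies the original one by convexity and upper hemicontinuity
([dual_equilibrium]).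
*)

Local Open Scope classical_set_scope.
Local Open Scope ring_scope.

(** * Limits of sequences *)

Section convergence.
Context {R : realType} {V : normedModType R}.
Implicit Types (u v : nat -> V) (p q : V) (g : nat -> R).

Lemma cvg_sqr_norm u p :
  u @ \oo --> p -> (fun n => `|u n| ^+ 2) @ \oo --> `|p| ^+ 2.
Proof. by move=> /cvg_norm up; exact: (cvgM up up). Qed.

Lemma cvg_sqr_dist u v p q : u @ \oo --> p -> v @ \oo --> q ->
  (fun n => `|u n - v n| ^+ 2) @ \oo --> `|p - q| ^+ 2.
Proof. by move=> up vq; apply: cvg_sqr_norm; exact: cvgB. Qed.

Lemma cvg_dist0 u v p : u @ \oo --> p -> v @ \oo --> p ->
  (fun n => `|u n - v n|) @ \oo --> (0 : R).
Proof.
by move=> up vp; rewrite -(normr0 V) -(subrr p); apply: cvg_norm; exact: cvgB.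
Qed.

Lemma cvg_dist_bound u v p g :
  v @ \oo --> p -> g @ \oo --> (0 : R) ->
  (\forall n \near \oo, `|u n - v n| <= g n) -> u @ \oo --> p.
Proof.
move=> vp g0 ug.
have uv0 : (fun n => u n - v n) @ \oo --> (0 : V).
  apply/cvgr0Pnorm_le => e e0; near=> n.
  apply: (@le_trans _ _ (g n)); first by near: n.
  by near: n; exact: cvgr_le g0 _ e0.
rewrite -[p]add0r (_ : u = fun n => (u n - v n) + v n); first exact: cvgD.
by apply/funext => n; rewrite subrK.
Unshelve. all: by end_near. Qed.

Lemma cvg_sqr_dist_bound u v p g :
  v @ \oo --> p -> g @ \oo --> (0 : R) ->
  (\forall n \near \oo, `|u n - v n| ^+ 2 <= g n) -> u @ \oo --> p.
Proof.
move=> vp g0 ug.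
apply: (@cvg_dist_bound u v p (fun n => Num.sqrt (g n))) => //.
  by rewrite -(sqrtr0 R); apply: continuous_cvg g0; exact: sqrt_continuous.
apply: filterS ug => n ug.
by rewrite -[leLHS]ger0_norm// -sqrtr_sqr ler_wsqrtr.
Qed.

End convergence.

(** This is how completeness enters: both the minimizing sequences of a distance
    and the iterates of the algorithm have squared gaps of this form. *)
Lemma sqr_gap_cvg (R : realType) (V : completeNormedModType R) (u : nat -> V)
    (g : nat -> R) : g @ \oo --> (0 : R) ->
  (forall m n, `|u m - u n| ^+ 2 <= g m + g n) -> cvgn u.
Proof.
move=> g0 ug; apply: cauchy_cvg; apply: cauchy_exP => e e0.
have e2 : 0 < e ^+ 2 / 2 by rewrite divr_gt0// exprn_gt0.
have [N _ gN] := cvgr_lt _ g0 _ e2.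
exists (u N); exists N => // n /= Nn.
rewrite -ball_normE/= -ltr_sqr ?nnegrE// ?ltW//.
apply: le_lt_trans (ug _ _) _.
by rewrite [ltRHS]splitr ltrD// gN//=.
Qed.

Lemma limf_esup_lt (R : realType) (T : choiceType) (X : filteredType T)
    (u : X -> \bar R) (F : set_system X) (a : \bar R) : Filter F ->
  (limf_esup u F < a)%E -> \forall t \near F, (u t < a)%E.
Proof.
move=> FF /ereal_inf_lt[_ [V FV <-] sup_lt].
apply: filterS FV => t Vt; apply: le_lt_trans sup_lt.
by apply: ereal_sup_ubound; exists t.
Qed.

Lemma limn_esup_lt (R : realType) (a : nat -> R) (b : R) :
  (limn_esup (fun n => (a n)%:E) < b%:E)%E ->
  exists2 c, c < b & \forall n \near \oo, a n <= c.
Proof.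
move=> /ereal_inf_lt[_ [V V_oo <-]].
have le_sup n : V n -> ((a n)%:E <= ereal_sup [set (a x)%:E | x in V])%E.
  by move=> Vn; apply: ereal_sup_ubound; exists n.
case: ereal_sup le_sup => [s||] le_sup // sb.
- exists s; first by rewrite -lte_fin.
  by apply: filterS V_oo => n /le_sup; rewrite lee_fin.
- exists (b - 1); first lra.
  by apply: filterS V_oo => n /le_sup; rewrite leeNy_eq.
Qed.

(** * Inner products *)

Section inner_product.
Context {R : realType} {H : completeNormedModType R} {dot : {dot H for idfun}}.
Hypothesis dotE : inner_product_norm dot.
Implicit Types u v w p q x y z : H.

Lemma dotC u v : dot u v = dot v u.
Proof. by rewrite hermC /= expr0 mul1r. Qed.

Lemma dotDl u v w : dot (u + v) w = dot u w + dot v w.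
Proof. exact: linearDl. Qed.

Lemma dotDr u v w : dot u (v + w) = dot u v + dot u w.
Proof. exact: linearDr. Qed.

Lemma dotNl u v : dot (- u) v = - dot u v.
Proof. exact: linearNl. Qed.

Lemma dotNr u v : dot u (- v) = - dot u v.
Proof. exact: linearNr. Qed.

Lemma dotZl (a : R) u v : dot (a *: u) v = a * dot u v.
Proof. exact: linearZl. Qed.

Lemma dotZr (a : R) u v : dot u (a *: v) = a * dot u v.
Proof. exact: linearZr. Qed.

Definition dot_expand := (dotDl, dotDr, dotNl, dotNr, dotZl, dotZr).

Lemma sqr_normB u v : `|u - v| ^+ 2 = `|u| ^+ 2 - 2 * dot u v + `|v| ^+ 2.
Proof. by rewrite -!dotE !dot_expand (dotC v u); ring. Qed.

(** The Stewart identity; at t = 1/2 it is the parallelogram identity, and it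
    contains all that is used of the strict convexity of the norm. *)
Lemma sqr_normB_convex (t : R) u v w :
  `|w - (t *: u + (1 - t) *: v)| ^+ 2 =
  t * `|w - u| ^+ 2 + (1 - t) * `|w - v| ^+ 2 - t * (1 - t) * `|u - v| ^+ 2.
Proof.
rewrite -!dotE !dot_expand (dotC u w) (dotC v w) (dotC v u); ring.
Qed.

Lemma dot_cvg (u v : nat -> H) p q : u @ \oo --> p -> v @ \oo --> q ->
  (fun n => dot (u n) (v n)) @ \oo --> dot p q.
Proof.
move=> up vq.
have polarization a b :
    dot a b = 2^-1 * (`|a| ^+ 2 + `|b| ^+ 2 - `|a - b| ^+ 2).
  by rewrite sqr_normB; field.
rewrite polarization (_ : (fun n => _) = fun n =>
  2^-1 * (`|u n| ^+ 2 + `|v n| ^+ 2 - `|u n - v n| ^+ 2)); last first.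
  by apply/funext => n; exact: polarization.
apply: cvgM; first exact: cvg_cst.
by apply: cvgB; [apply: cvgD|]; [exact: cvg_sqr_norm..|exact: cvg_sqr_dist].
Qed.

End inner_product.

(** * Convexity and metric projections *)

Section convexity.
Context (R : realType) (H : completeNormedModType R).
Implicit Types (u v x y : H) (C D : set H).

Lemma convex_setE D : convex_set D <->
  forall u v (t : R), D u -> D v -> 0 <= t -> t <= 1 ->
  D (t *: u + (1 - t) *: v).
Proof.
split=> cD.
  move=> u v t Du Dv t0 t1.
  by have := cD u v (Itv01 t0 t1) (mem_set Du) (mem_set Dv); rewrite inE.
move=> u v t /set_mem Du /set_mem Dv; apply/mem_set.
exact: (cD u v t%:num).
Qed.

Lemma convex_functionE D (f : H -> R) : convex_function D f ->
  forall u v (t : R), D u -> D v -> 0 <= t -> t <= 1 ->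
  f (t *: u + (1 - t) *: v) <= t * f u + (1 - t) * f v.
Proof.
move=> cf u v t Du Dv t0 t1.
exact: (cf (Itv01 t0 t1) u v (mem_set Du) (mem_set Dv)).
Qed.

End convexity.

Section projection.
Context {R : realType} {H : completeNormedModType R} {dot : {dot H for idfun}}.
Hypothesis dotE : inner_product_norm dot.
Implicit Types (p q u v x z : H) (D F : set H).

(** A minimizing sequence is Cauchy: the midpoint of two distant points that
    almost minimize would be closer to x than the infimum. *)
Lemma nearest_point_exists D x : D !=set0 -> closed D -> convex_set D ->
  exists p, D p /\ forall q, D q -> `|x - p| <= `|x - q|.
Proof.
move=> [q0 Dq0] closedD /convex_setE convexD.
pose E := [set `|x - q| ^+ 2 | q in D].
have infE : has_inf E.
  split; first by exists (`|x - q0| ^+ 2), q0.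
  by exists 0 => _ [q _ <-]; exact: exprn_ge0.
have infE_le q : D q -> inf E <= `|x - q| ^+ 2.
  by move=> Dq; apply: ge_inf; [case: infE|exists q].
have /choice[u uP] (n : nat) :
    exists q, D q /\ `|x - q| ^+ 2 <= inf E + harmonic n.
  have [_ [q Dq <-] qn] := inf_adherent (harmonic_gt0 (R := R) n) infE.
  by exists q; split=> //; exact: ltW.
have Du n : D (u n) by case: (uP n).
(* The parallelogram identity at the midpoint of u m and u n. *)
have gap m n :
    `|u m - u n| ^+ 2 <= 2 * harmonic m + 2 * harmonic n.
  have half : 0 <= 2^-1 :> R /\ 2^-1 <= 1 :> R by split; lra.
  have := infE_le _ (convexD _ _ _ (Du m) (Du n) half.1 half.2).
  rewrite (sqr_normB_convex dotE).
  have [_] := uP m; have [_] := uP n.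
  set a := `|x - u m| ^+ 2; set b := `|x - u n| ^+ 2.
  set c := `|u m - u n| ^+ 2; set hm := harmonic m; set hn := harmonic n.
  by move=> *; nra.
have g0 : (fun n => 2 * harmonic n) @ \oo --> (0 : R).
  by rewrite -[0 in X in _ --> X](mulr0 2); apply: cvgM cvg_harmonic;
    exact: cvg_cst.
have /cvg_ex[p up] := sqr_gap_cvg g0 gap.
exists p; split.
  by apply: (@closed_cvg _ _ \oo _ u D closedD _ _ up); exact: nearW.
move=> q /infE_le infq; rewrite -ler_sqr ?nnegrE//.
apply: le_trans infq; rewrite -[leRHS]addr0.
apply: (@ler_cvg_to _ \oo _ _ (fun n => `|x - u n| ^+ 2)
                           (fun n => inf E + harmonic n)).
- by apply: cvg_sqr_dist => //; exact: cvg_cst.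
- by apply: cvgD; [exact: cvg_cst|exact: cvg_harmonic].
- by apply: nearW => n; case: (uP n).
Qed.

(** The angle at p of the triangle x, p, q is not acute, written without the
    inner product: the Pythagorean equality becomes an inequality. *)
Lemma nearest_point_obtuse D x p : convex_set D -> D p ->
  (forall q, D q -> `|x - p| <= `|x - q|) ->
  forall q, D q -> `|p - q| ^+ 2 <= `|x - q| ^+ 2 - `|x - p| ^+ 2.
Proof.
move=> /convex_setE convexD Dp pmin q Dq.
set a := `|x - q| ^+ 2; set b := `|x - p| ^+ 2; set s := `|p - q| ^+ 2.
have ba : b <= a by rewrite ler_sqr ?nnegrE//; exact: pmin.
rewrite leNgt; apply/negP => abs.
have s0 : 0 < s by lra.
(* Moving from p towards q by this fraction of the way changes the squared
   distance to x by t * (a - b - (1 - t) * s), which is negative. *)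
pose t := (s - (a - b)) / (2 * s).
have t0 : 0 < t by rewrite divr_gt0//; lra.
have t1 : t <= 1 by rewrite ler_pdivrMr ?mul1r; lra.
have ts : t * s = (s - (a - b)) / 2 by rewrite /t; field; rewrite gt_eqF.
have := pmin _ (convexD _ _ _ Dq Dp (ltW t0) t1).
rewrite -ler_sqr ?nnegrE// (sqr_normB_convex dotE) (distrC q p) -/a -/b -/s.
suff : t * (a - b - (1 - t) * s) < 0 by lra.
by rewrite pmulr_rlt0// mulrBl mul1r ts; lra.
Qed.

Lemma metric_projP D x : D !=set0 -> closed D -> convex_set D ->
  D (metric_proj D x) /\
  forall q, D q -> `|x - metric_proj D x| <= `|x - q|.
Proof.
move=> D0 closedD convexD.
have [p pP] := nearest_point_exists x D0 closedD convexD.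
by rewrite /metric_proj; case: xgetP => [//|/(_ p)].
Qed.

Lemma metric_proj_obtuse D x q : closed D -> convex_set D -> D q ->
  `|metric_proj D x - q| ^+ 2 <= `|x - q| ^+ 2 - `|x - metric_proj D x| ^+ 2.
Proof.
move=> closedD convexD Dq.
have [|DP Pmin] := @metric_projP D x _ closedD convexD; first by exists q.
exact: nearest_point_obtuse Dq.
Qed.

(** The converse of the obtuse angle property: at another nearest point q the
    right-hand side vanishes, so q = p. *)
Lemma metric_proj_eq F x p : F p ->
  (forall q, F q -> `|p - q| ^+ 2 <= `|x - q| ^+ 2 - `|x - p| ^+ 2) ->
  metric_proj F x = p.
Proof.
move=> Fp obtuse; apply: xget_unique.
  split=> // q /obtuse pq; rewrite -ler_sqr ?nnegrE//.
  by have := exprn_ge0 2 (normr_ge0 (p - q)); lra.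
move=> q [Fq qmin].
have pq := obtuse _ Fq.
have := qmin _ Fp; rewrite -ler_sqr ?nnegrE// => qp.
have : `|p - q| ^+ 2 <= 0 by lra.
by rewrite real_exprn_even_le0//= normr_eq0 subr_eq0 => /eqP.
Qed.

(** By the obtuse angle property on Cs m, the squared distances from x 0 to x m
    increase by at least the squared gaps, and stay below the distance to F. *)
Lemma nested_projections_cvg (Cs : nat -> set H) (x : nat -> H) F :
  (forall n, closed (Cs n)) -> (forall n, convex_set (Cs n)) ->
  (forall n, Cs n.+1 `<=` Cs n) ->
  F !=set0 -> (forall n, F `<=` Cs n) ->
  (forall n, x n = metric_proj (Cs n) (x 0%N)) ->
  exists p, x @ \oo --> p /\
    forall q, F q -> `|p - q| ^+ 2 <= `|x 0%N - q| ^+ 2 - `|x 0%N - p| ^+ 2.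
Proof.
move=> closedC convexC nested [v Fv] FC xE.
pose s n := `|x 0%N - x n| ^+ 2.
have Cx n : Cs n (x n).
  rewrite xE; apply: (metric_projP _ _ (closedC n) (convexC n)).1.
  by exists v; exact: FC.
have CsS m n : (m <= n)%N -> Cs n `<=` Cs m.
  move=> /subnK <-; elim: (n - m)%N => // k IH.
  by apply: subset_trans IH; exact: nested.
have obtuse n q : Cs n q -> `|x n - q| ^+ 2 <= `|x 0%N - q| ^+ 2 - s n.
  move=> Cq; have := metric_proj_obtuse (x 0%N) (closedC n) (convexC n) Cq.
  by rewrite -xE.
have s_gap m n : (m <= n)%N -> `|x m - x n| ^+ 2 <= s n - s m.
  by move=> mn; apply: obtuse; exact: CsS (Cx n).
have s_nondec : {homo s : m n / (m <= n)%N >-> m <= n}.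
  move=> m n /s_gap; have := exprn_ge0 2 (normr_ge0 (x m - x n)); lra.
have s_ub : has_ubound (range s).
  exists (`|x 0%N - v| ^+ 2) => _ [n _ <-].
  have := obtuse n v (FC n v Fv).
  have := exprn_ge0 2 (normr_ge0 (x n - v)); lra.
have s_cvg : cvgn s by exact: nondecreasing_is_cvgn.
have s_le n : s n <= limn s by exact: nondecreasing_cvgn_le.
have g0 : (fun n => limn s - s n) @ \oo --> (0 : R).
  by rewrite -(subrr (limn s)); apply: cvgB => //; exact: cvg_cst.
have gap m n : `|x m - x n| ^+ 2 <= (limn s - s m) + (limn s - s n).
  have sm := s_le m; have sn := s_le n.
  have [/s_gap|/ltnW/s_gap] := leqP m n; first lra.
  by rewrite distrC; lra.
have /cvg_ex[p xp] := sqr_gap_cvg g0 gap.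
exists p; split=> // q Fq.
apply: (@ler_cvg_to _ \oo _ _ (fun n => `|x n - q| ^+ 2)
                           (fun n => `|x 0%N - q| ^+ 2 - s n)).
- by apply: cvg_sqr_dist => //; exact: cvg_cst.
- apply: cvgB; first exact: cvg_cst.
  by apply: cvg_sqr_dist => //; exact: cvg_cst.
- by apply: nearW => n; apply: obtuse; exact: FC.
Qed.

Lemma closed_bisector x z (c : R) :
  closed [set v | `|z - v| ^+ 2 <= `|x - v| ^+ 2 + c].
Proof.
rewrite (_ : [set _ | _] = (fun v => `|z - v| ^+ 2 - `|x - v| ^+ 2) @^-1`
  [set a | a <= c]); last first.
  by apply/seteqP; split=> v /=; rewrite lerBlDl.
apply: preimage_closed; last exact: closed_le.
have dist_continuous w : continuous (fun v => `|w - v|).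
  by move=> v; apply: cvg_norm; apply: cvgB; [exact: cvg_cst|exact: cvg_id].
by move=> v _; apply: cvgB; apply: cvgM; exact: dist_continuous.
Qed.

(** By the Stewart identity the difference of the two squared distances is
    affine in v: the set is a half-space. *)
Lemma convex_bisector x z (c : R) :
  convex_set [set v | `|z - v| ^+ 2 <= `|x - v| ^+ 2 + c].
Proof.
apply/convex_setE => u v t /= hu hv t0 t1.
rewrite !(sqr_normB_convex dotE).
have := ler_wpM2l t0 hu.
have := ler_wpM2l (_ : 0 <= 1 - t) hv; rewrite subr_ge0 => /(_ t1).
lra.
Qed.

End projection.

(** * Equilibrium problems and resolvents *)

Section equilibrium.
Context {R : realType} {H : completeNormedModType R} {dot : {dot H for idfun}}.
Hypothesis dotE : inner_product_norm dot.
Context (C : set H).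
Implicit Types (p q u v w x y z : H) (f : H -> H -> R) (A : H -> H).

(** By the Cauchy-Schwarz inequality, A is Lipschitz with constant 1 / alpha. *)
Lemma ism_cvg (alpha : R) A (x : nat -> H) p : 0 < alpha ->
  inverse_strongly_monotone dot C alpha A -> (forall n, C (x n)) -> C p ->
  x @ \oo --> p -> (fun n => A (x n)) @ \oo --> A p.
Proof.
move=> alpha0 Aism Cx Cp xp.
apply: (@cvg_sqr_dist_bound _ _ _ (fun=> A p) _
  (fun n => alpha^-1 ^+ 2 * `|x n - p| ^+ 2)).
- exact: cvg_cst.
- rewrite -[0](mulr0 (alpha^-1 ^+ 2)); apply: cvgM; first exact: cvg_cst.
  rewrite -[0](expr0n _ 2) -(normr0 H) -(subrr p).
  by apply: cvg_sqr_dist => //; exact: cvg_cst.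
apply: nearW => n.
set D := A (x n) - A p.
have := Aism _ _ (Cx n) Cp; rewrite -/D => AD.
(* The Cauchy-Schwarz inequality between D and x n - p, with the weight alpha
   for which both sides of AD are comparable. *)
have := exprn_ge0 2 (normr_ge0 (alpha *: D - (x n - p))).
rewrite (sqr_normB dotE (alpha *: D)) normrZ (gtr0_norm alpha0) exprMn dotZl.
move=> sq.
rewrite exprVn mulrC ler_pdivlMr ?exprn_gt0//.
have := ler_wpM2l (ltW alpha0) AD.
set a := `|D| ^+ 2 in sq *; set b := `|x n - p| ^+ 2 in sq *.
set c := dot _ _ in sq *; rewrite mulrA -expr2 => h.
nra.
Qed.

(** The resolvent sends the forward step p - r *: A p back to p.  The forward
    steps of x and p are closer than x and p, the squared distance losing at
    least r * (2 * alpha - r) times the squared norm of A x - A p; the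
    resolvent, being firmly nonexpansive, takes away at least the squared norm
    of z - x + r *: (A x - A p) as well.  These two losses together control the
    squared norm of z - x. *)
Lemma resolvent_step f A (alpha r : R) x z p :
  equilibrium_bifunction C f -> inverse_strongly_monotone dot C alpha A ->
  0 < r <= 2 * alpha -> C x -> GEP dot C f A p ->
  is_resolvent dot C f r (x - r *: A x) z ->
  (2 * alpha - r) * `|z - x| ^+ 2 <=
    4 * alpha * (`|x - p| ^+ 2 - `|z - p| ^+ 2).
Proof.
move=> fE Aism /andP[r0 ra] Cx [Cp pP] [Cz zP].
have mono := bifun_A2 fE Cz Cp.
have fp := pP _ Cz; have fz := zP _ Cp.
pose D := A x - A p; pose c := (x - p) - r *: D.
(* In the sum of the two equilibrium inequalities, monotonicity removes f and
   leaves the firm nonexpansiveness of the resolvent. *)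
have firm : 0 <= dot (z - p) (c - (z - p)).
  have : 0 <= r * (dot (A p) (z - p) + r^-1 * dot (p - z) (z - (x - r *: A x))).
    by apply: mulr_ge0; [exact: ltW|lra].
  rewrite mulrDr mulVKf ?gt_eqF// => firm.
  suff : dot (z - p) (c - (z - p)) =
    r * dot (A p) (z - p) + dot (p - z) (z - (x - r *: A x)) by lra.
  rewrite /c /D !(dotC (A p)) !dot_expand; ring.
set a := x - p in c firm *; set b := z - p in firm *.
have -> : z - x = (b - c) - r *: D.
  by rewrite /c opprB addrA [in RHS]addrAC addrK /b /a opprB addrA subrK.
have b_le : `|b| ^+ 2 <= `|c| ^+ 2 - `|b - c| ^+ 2.
  rewrite (sqr_normB dotE b c); move: firm.
  by rewrite (dotDr b c) dotNr dotE; lra.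
have c_le : `|c| ^+ 2 <= `|a| ^+ 2 - r * (2 * alpha - r) * `|D| ^+ 2.
  rewrite /c (sqr_normB dotE a) normrZ (gtr0_norm r0) exprMn dotZr.
  have := ler_wpM2l (ltW r0) (Aism _ _ Cx Cp); rewrite -/D -/a (dotC D).
  lra.
have tri : `|(b - c) - r *: D| ^+ 2 <=
    2 * `|b - c| ^+ 2 + 2 * (r ^+ 2 * `|D| ^+ 2).
  have := exprn_ge0 2 (normr_ge0 ((b - c) - (- (r *: D)))).
  rewrite !(sqr_normB dotE (b - c)) dotNr normrN normrZ (gtr0_norm r0) exprMn.
  lra.
have := @ler_wpM2l _ (2 * alpha - r) _ _ _ tri; rewrite subr_ge0 => /(_ ra).
move/le_trans; apply.
set Q := `|b - c| ^+ 2 in b_le *; set T := `|D| ^+ 2 in c_le *.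
have Q0 : 0 <= Q by exact: exprn_ge0.
have : 4 * alpha * (Q + r * (2 * alpha - r) * T) <=
    4 * alpha * (`|a| ^+ 2 - `|b| ^+ 2).
  by apply: ler_wpM2l; lra.
apply: le_trans.
have T0 : 0 <= r * (2 * alpha - r) * T.
  by apply: mulr_ge0; [apply: mulr_ge0; lra|exact: exprn_ge0].
have := mulr_ge0 (ltW r0) Q0.
have : 0 <= (2 * alpha - r) * (r * (2 * alpha - r) * T) by apply: mulr_ge0; lra.
lra.
Qed.

(** The passage from the topology of [subspace C] to sequences in C. *)
Lemma lsc_subspace_le (g : H -> R) (z : nat -> H) (h : nat -> R) p l :
  lower_semicontinuous (fun y : subspace C => (g y)%:E) -> C p ->
  (forall n, C (z n)) -> z @ \oo --> p -> h @ \oo --> l ->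
  (\forall n \near \oo, g (z n) <= h n) -> g p <= l.
Proof.
move=> lsc Cp Cz zp hl gh; rewrite leNgt; apply/negP => lg.
pose a := (l + g p) / 2.
have [V pV aV] : exists2 V : set (subspace C), nbhs (p : subspace C) V &
    forall y, V y -> (a%:E < (g y)%:E)%E.
  by apply: lsc; rewrite lte_fin /a; lra.
have zV : \forall n \near \oo, V (z n).
  suff : z @ \oo --> (p : subspace C) by exact.
  apply/subspace_cvgP => // W pW.
  have : \forall n \near \oo, C (z n) -> W (z n) by exact: zp pW.
  by apply: (@filterS _ \oo) => n /(_ (Cz n)).
have ha : \forall n \near \oo, h n < a.
  by apply: cvgr_lt hl _ _; rewrite /a; lra.
have /filter_ex[n [Vn [hn gn]]] :
    \forall n \near \oo, V (z n) /\ h n < a /\ g (z n) <= h n.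
  by near=> n; split; [|split]; near: n.
by move: (aV _ Vn); rewrite lte_fin; lra.
Unshelve. all: by end_near. Qed.

(** The Minty trick.  At a point wt between p and w, convexity splits the zero
    f wt wt into parts at w and at p; the dual inequality bounds the part at p
    from above, hence f wt w from below, and upper hemicontinuity takes this
    bound to the limit as wt tends to p. *)
Lemma dual_equilibrium f p v : convex_set C -> equilibrium_bifunction C f ->
  C p -> (forall w, C w -> f w p <= dot v (w - p)) ->
  forall w, C w -> 0 <= f p w + dot v (w - p).
Proof.
move=> /convex_setE convexC fE Cp dual w Cw; set c := dot v (w - p).
rewrite leNgt; apply/negP => neg.
pose a := (f p w - c) / 2.
have upper : \forall t \near (0 : R)^'+, f (t *: w + (1 - t) *: p) w < a.
  have : (limf_esup (fun t : R => (f (t *: w + (1 - t) *: p) w)%:E)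
      (0 : R)^'+ < a%:E)%E.
    by apply: le_lt_trans (bifun_A3 fE Cp Cw Cw) _; rewrite lte_fin /a; lra.
  by move=> /limf_esup_lt; apply: filterS => t; rewrite lte_fin.
have lower : \forall t \near (0 : R)^'+, a < - ((1 - t) * c).
  have : (fun t : R => - ((1 - t) * c)) @ (0 : R)^'+ --> - ((1 - 0) * c).
    apply: cvgN; apply: cvgM; last exact: cvg_cst.
    by apply: cvgB; [exact: cvg_cst|exact: cvg_within_filter cvg_id].
  by move=> /cvgr_gt; apply; rewrite subr0 mul1r /a; lra.
have /filter_ex[t [t0 [t1 [ft tc]]]] : \forall t \near (0 : R)^'+,
    0 < t /\ t < 1 /\ f (t *: w + (1 - t) *: p) w < a /\ a < - ((1 - t) * c).
  near=> t; split; first by near: t; exact: nbhs_right_gt.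
  split; first by near: t; exact: nbhs_right_lt.
  by split; near: t.
set wt := t *: w + (1 - t) *: p in ft.
have Cwt : C wt by exact: (convexC _ _ _ Cw Cp (ltW t0) (ltW t1)).
have [convexf _] := bifun_A4 fE Cwt.
have := convex_functionE convexf Cw Cp (ltW t0) (ltW t1).
rewrite -/wt (bifun_A1 fE Cwt).
have := dual _ Cwt.
have -> : wt - p = t *: (w - p).
  by rewrite /wt scalerBl scale1r scalerBr [p - _]addrC addrA addrK.
rewrite dotZr -/c => fwt.
have : (1 - t) * f wt p <= (1 - t) * (t * c) by apply: ler_wpM2l => //; lra.
have : t * f wt w < t * (- ((1 - t) * c)) by rewrite ltr_pM2l//; lra.
lra.
Unshelve. all: by end_near. Qed.

(** By monotonicity the resolvent inequality at z n bounds f w (z n) from above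
    by quantities that converge, so the limit p solves the dual problem. *)
Lemma resolvent_limit f A (alpha d : R) (r : nat -> R) (x z : nat -> H) p :
  closed C -> convex_set C -> equilibrium_bifunction C f ->
  0 < alpha -> inverse_strongly_monotone dot C alpha A ->
  0 < d -> (forall n, d <= r n) -> (forall n, C (x n)) ->
  (forall n, is_resolvent dot C f (r n) (x n - r n *: A (x n)) (z n)) ->
  x @ \oo --> p -> z @ \oo --> p -> GEP dot C f A p.
Proof.
move=> closedC convexC fE alpha0 Aism d0 dr Cx zP xp zp.
have Cz n : C (z n) by case: (zP n).
have Cp : C p.
  by apply: (@closed_cvg _ _ \oo _ x C closedC _ _ xp); exact: nearW.
have Axp := ism_cvg alpha0 Aism Cx Cp xp.
split=> //; apply: dual_equilibrium => // w Cw.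
have rn0 n : 0 < r n by exact: lt_le_trans (dr n).
have quot0 : (fun n => (r n)^-1 *: (z n - x n)) @ \oo --> (0 : H).
  apply: (@cvg_dist_bound _ _ _ (fun=> 0) _ (fun n => d^-1 * `|z n - x n|)).
  - exact: cvg_cst.
  - rewrite -[0](mulr0 d^-1); apply: cvgM; first exact: cvg_cst.
    exact: cvg_dist0 zp xp.
  apply: nearW => n; rewrite subr0 normrZ gtr0_norm ?invr_gt0//.
  by apply: ler_wpM2r => //; rewrite lef_pV2 ?posrE.
have [_ lsc] := bifun_A4 fE Cw.
apply: (lsc_subspace_le (h := fun n => dot (A (x n)) (w - z n) +
  dot (w - z n) ((r n)^-1 *: (z n - x n))) lsc Cp Cz zp).
  rewrite -[dot (A p) _]addr0 -[X in _ + X](linear0r dot (w - p)).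
  have wz : (fun n => w - z n) @ \oo --> w - p.
    by apply: cvgB => //; exact: cvg_cst.
  by apply: cvgD; exact: dot_cvg.
apply: nearW => n; have [_ /(_ w Cw) zw] := zP n.
have mono := bifun_A2 fE Cw (Cz n).
suff : (r n)^-1 * dot (w - z n) (z n - (x n - r n *: A (x n))) =
    dot (A (x n)) (w - z n) + dot (w - z n) ((r n)^-1 *: (z n - x n)) by lra.
by rewrite (dotC (A _)) !dot_expand; field; rewrite gt_eqF.
Qed.

End equilibrium.

(** * Asymptotically strict pseudocontractions *)

(** If b exceeds a, division by b bounds the right-hand side by a multiple of
    a, except for the term kappa * b that the left-hand side absorbs. *)
Lemma quadratic_root_bound (R : realFieldType) (kappa K a b : R) :
  0 <= kappa -> kappa < 1 -> 1 <= K -> 0 <= a -> 0 <= b ->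
  b ^+ 2 <= K * a ^+ 2 + kappa * (a + b) ^+ 2 ->
  b <= (K + 3) / (1 - kappa) * a.
Proof.
move=> kappa0 kappa1 K1 a0 b0 le_b.
rewrite mulrAC ler_pdivlMr ?subr_gt0// mulrC.
have [ba|/ltW ab] := leP b a.
  apply: (@le_trans _ _ (1 * a)); last by apply: ler_wpM2r => //; lra.
  by apply: ler_pM; lra.
have [->|b_neq0] := eqVneq b 0; first by rewrite mulr0; apply: mulr_ge0; lra.
have b_gt0 : 0 < b by rewrite lt_neqAle eq_sym b_neq0.
rewrite -(ler_pM2r b_gt0).
have ab0 : 0 <= a * b by exact: mulr_ge0.
have aa : a * a <= a * b by exact: ler_wpM2l.
have Kaa : K * (a * a) <= K * (a * b) by apply: ler_wpM2l => //; lra.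
have kaa : kappa * (a * a) <= 1 * (a * b).
  by apply: ler_pM => //; [exact: mulr_ge0|lra].
have kab : kappa * (a * b) <= 1 * (a * b) by apply: ler_wpM2r; lra.
lra.
Qed.

(** The reason why small displacements of the averaged point and of y force a
    small displacement of the iterate s. *)
Lemma mann_displacement (R : pzRingType) (V : lmodType R) (a b : R)
    (x y s : V) :
  (a *: x + (1 - a) *: (b *: y + (1 - b) *: s) - x) - ((1 - a) * b) *: (y - x) =
  ((1 - a) * (1 - b)) *: (s - x).
Proof.
have translate t u w :
    t *: (u + x) + (1 - t) *: (w + x) = (t *: u + (1 - t) *: w) + x.
  by rewrite !scalerDr addrACA -scalerDl [t + _]addrC subrK scale1r.
rewrite -[in X in X - x](subrK x y) -[in X in X - x](subrK x s) translate.
rewrite -{1}[x]add0r translate scaler0 add0r addrK scalerDr !scalerA.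
by rewrite addrAC subrr add0r.
Qed.

Section pseudocontraction.
Context {R : realType} {H : completeNormedModType R} {dot : {dot H for idfun}}.
Hypothesis dotE : inner_product_norm dot.
Context (C : set H) (kappa : R) (k : nat -> R) (S : H -> H).
Hypotheses (kappa_ge0 : 0 <= kappa) (kappa_lt1 : kappa < 1).
Hypotheses (k_ge1 : forall n, 1 <= k n) (k_cvg : k @ \oo --> (1 : R)).
Hypothesis S_asp : asymptotically_strictly_pseudocontractive C kappa k S.
Implicit Types p v w x y : H.

Lemma asp_iter_in n x : C x -> C (iter n S x).
Proof. by move=> Cx; elim: n => //= n; case: S_asp => CS _; exact: CS. Qed.

Lemma asp_iter_lipschitz n x y : (1 <= n)%N -> C x -> C y ->
  `|iter n S x - iter n S y| <= (k n + 3) / (1 - kappa) * `|x - y|.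
Proof.
move=> n1 Cx Cy; have [_ /(_ n x y n1 Cx Cy)] := S_asp.
rewrite (_ : (x - iter n S x) - (y - iter n S y) =
  (x - y) - (iter n S x - iter n S y)); last by rewrite !opprD addrACA.
set X := x - y; set Y := iter n S x - iter n S y => le_Y.
have tri := ler_normB X Y.
have sq_tri : `|X - Y| ^+ 2 <= (`|X| + `|Y|) ^+ 2.
  by rewrite ler_sqr ?nnegrE// addr_ge0.
apply: quadratic_root_bound => //; apply: (le_trans le_Y).
by rewrite lerD2l; exact: ler_wpM2l.
Qed.

(** The Lipschitz constants of the iterates converge, so iter n S p has the
    same limit p as iter n S (u n); and if the iterates of a continuous map at a
    point converge, their limit is a fixed point. *)
Lemma asp_fixed_limit (u : nat -> H) p : (forall n, C (u n)) -> C p ->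
  u @ \oo --> p -> (fun n => iter n S (u n)) @ \oo --> p -> S p = p.
Proof.
move=> Cu Cp up Sup.
have Sp : (fun n => iter n S p) @ \oo --> p.
  apply: (@cvg_dist_bound _ _ _ (fun n => iter n S (u n)) _
    (fun n => (k n + 3) / (1 - kappa) * `|p - u n|)) => //.
    rewrite -[0](mulr0 ((1 + 3) / (1 - kappa))); apply: cvgM.
      apply: cvgM; last exact: cvg_cst.
      by apply: cvgD => //; exact: cvg_cst.
    by apply: (cvg_dist0 (p := p)) => //; exact: cvg_cst.
  by exists 1%N => // n /= n1; exact: asp_iter_lipschitz.
have SSp : (fun n => iter n.+1 S p) @ \oo --> S p.
  apply: (@cvg_dist_bound _ _ _ (fun=> S p) _
    (fun n => (k 1%N + 3) / (1 - kappa) * `|iter n S p - p|)).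
  - exact: cvg_cst.
  - rewrite -[0](mulr0 ((k 1%N + 3) / (1 - kappa))); apply: cvgM.
      exact: cvg_cst.
    by apply: (cvg_dist0 (p := p)) => //; exact: cvg_cst.
  - apply: nearW => n.
    exact: (@asp_iter_lipschitz 1 _ _ _ (asp_iter_in n Cp) Cp).
have SSp' : (fun n => iter n.+1 S p) @ \oo --> p.
  by rewrite (cvg_shiftS (fun n => iter n S p)).
exact: (cvg_unique _ SSp SSp').
Qed.

(** The defect term with kappa is absorbed by the strict convexity of the norm,
    as be is at least kappa. *)
Lemma asp_averaged_step n (be : R) y v : kappa <= be <= 1 -> C y ->
  fixed_points C S v ->
  `|be *: y + (1 - be) *: iter n S y - v| ^+ 2 <= k n * `|y - v| ^+ 2.
Proof.
move=> /andP[kbe be1] Cy [Cv Sv].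
have Snv m : iter m S v = v by exact: iter_fix.
have yv := exprn_ge0 2 (normr_ge0 (y - v)).
case: n => [|n].
  rewrite /= -scalerDl [be + _]addrC subrK scale1r.
  by rewrite -[leLHS]mul1r; exact: ler_wpM2r.
have [_ /(_ n.+1 y v isT Cy Cv)] := S_asp.
rewrite Snv (_ : _ - (v - v) = y - iter n.+1 S y); last by rewrite subrr subr0.
rewrite [in X in _ -> X <= _]distrC (sqr_normB_convex dotE) !(distrC v).
move: (iter n.+1 S y) (k_ge1 n.+1) => Sy; move: (k n.+1) => K K1.
have := exprn_ge0 2 (normr_ge0 (y - Sy)).
move: yv; set a := `|y - v| ^+ 2; set b := `|Sy - v| ^+ 2.
set s := `|y - Sy| ^+ 2 => a0 s0 le_b.
have := ler_wpM2l (_ : 0 <= 1 - be) le_b; rewrite subr_ge0 => /(_ be1) h1.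
have h2 : 0 <= (1 - be) * ((be - kappa) * s).
  by apply: mulr_ge0; [|apply: mulr_ge0]; lra.
have h3 : be * a <= be * (K * a).
  apply: ler_wpM2l; first exact: le_trans kbe.
  by rewrite -[leLHS]mul1r; exact: ler_wpM2r.
lra.
Qed.

(** Dropping the second summand shows that v is not cut off; keeping it forces
    y to be as far from v as x in the limit. *)
Lemma asp_mann_step n (al be : R) x y v : 0 <= al <= 1 -> kappa <= be <= 1 ->
  C y -> fixed_points C S v -> `|y - v| ^+ 2 <= `|x - v| ^+ 2 ->
  `|al *: x + (1 - al) *: (be *: y + (1 - be) *: iter n S y) - v| ^+ 2 +
    (1 - al) * (`|x - v| ^+ 2 - `|y - v| ^+ 2) <= k n * `|x - v| ^+ 2.
Proof.
move=> /andP[al0 al1] be_range Cy Sv yx.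
have := asp_averaged_step n be_range Cy Sv.
move: (be *: y + _) => w wv; rewrite [in X in X + _]distrC.
rewrite (sqr_normB_convex dotE) (distrC v x) (distrC v w).
have s0 : 0 <= al * (1 - al) * `|x - w| ^+ 2.
  by rewrite !mulr_ge0 ?subr_ge0 ?exprn_ge0.
have Y0 := exprn_ge0 2 (normr_ge0 (y - v)).
move: wv yx s0 Y0 (k_ge1 n); set X := `|x - v| ^+ 2; set Y := `|y - v| ^+ 2.
move: (`|w - v| ^+ 2) (`|x - w| ^+ 2) (k n) => W s K wv yx s0 Y0 K1.
have h1 : (1 - al) * W <= (1 - al) * (K * Y).
  by apply: ler_wpM2l; rewrite ?subr_ge0.
have h2 : (1 - al) * ((K - 1) * Y) <= 1 * ((K - 1) * X).
  apply: ler_pM; rewrite ?subr_ge0 ?gerBl//.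
    by rewrite mulr_ge0 ?subr_ge0.
  by apply: ler_wpM2l; rewrite ?subr_ge0.
lra.
Qed.

End pseudocontraction.

(** * The hybrid projection algorithm *)

Theorem theorem2 (R : realType) (H : completeNormedModType R)
  (dot : {dot H for idfun}) (dotE : inner_product_norm dot)
  (C : set H) (C_nonempty : C !=set0) (C_closed : closed C)
  (C_convex : convex_set C)
  (N M : nat)
  (f : 'I_N -> H -> H -> R) (A : 'I_N -> H -> H) (S : 'I_M -> H -> H)
  (alpha kappa : R) (k : nat -> R)
  (f_equil : forall i, equilibrium_bifunction C (f i))
  (alpha_gt0 : 0 < alpha)
  (A_ism : forall i, inverse_strongly_monotone dot C alpha (A i))
  (kappa_ge0 : 0 <= kappa) (kappa_lt1 : kappa < 1)
  (k_ge1 : forall n, 1 <= k n) (k_cvg : k @ \oo --> (1 : R))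
  (S_asp : forall j, asymptotically_strictly_pseudocontractive C kappa k (S j))
  (F : set H)
  (F_def : F = (\bigcap_(i in [set: 'I_N]) GEP dot C (f i) (A i)) `&`
               (\bigcap_(j in [set: 'I_M]) fixed_points C (S j)))
  (F_nonempty : F !=set0) (F_bounded : bounded_set F)
  (omega : R) (omega_gt0 : 0 < omega)
  (omega_bound : forall v, F v -> `|v| <= omega)
  (al be r : nat -> R)
  (al_range : forall n, 0 < al n < 1)
  (al_limsup : (limn_esup (fun n => (al n)%:E) < 1)%E)
  (b : R) (b_range : kappa < b < 1)
  (be_range : forall n, kappa <= be n <= b)
  (d e : R) (d_gt0 : 0 < d) (e_lt : e < 2 * alpha)
  (r_range : forall n, d <= r n <= e)
  (x : nat -> H) (y : nat -> 'I_N -> H) (z : nat -> 'I_M -> H)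
  (i_ : nat -> 'I_N) (j_ : nat -> 'I_M) (Cs : nat -> set H)
  (x0_in : C (x 0%N))
  (Cs0 : Cs 0%N = C)
  (y_def : forall n i,
     is_resolvent dot C (f i) (r n) (x n - r n *: A i (x n)) (y n i))
  (i_argmax : forall n i, `|y n i - x n| <= `|y n (i_ n) - x n|)
  (z_def : forall n j,
     z n j = al n *: x n +
       (1 - al n) *: (be n *: y n (i_ n) +
                      (1 - be n) *: iter n (S j) (y n (i_ n))))
  (j_argmax : forall n j, `|z n j - x n| <= `|z n (j_ n) - x n|)
  (CsS : forall n,
     Cs n.+1 = [set v | Cs n v /\
       `|z n (j_ n) - v| ^+ 2 <=
         `|x n - v| ^+ 2 + (k n - 1) * (`|x n| + omega) ^+ 2])
  (xS : forall n, x n.+1 = metric_proj (Cs n.+1) (x 0%N)) :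
  [/\ x @ \oo --> metric_proj F (x 0%N),
      forall i, (fun n => y n i) @ \oo --> metric_proj F (x 0%N) &
      forall j, (fun n => z n j) @ \oo --> metric_proj F (x 0%N)].
Proof.
have alpha2 : 0 < 2 * alpha - e by lra.
have /andP[_ b1] := b_range.
have al01 n : 0 <= al n <= 1 by have /andP[/ltW-> /ltW->] := al_range n.
have be01 n : kappa <= be n <= 1.
  by have /andP[-> /= /le_trans->//] := be_range n; exact: ltW.
have r02 n : 0 < r n <= 2 * alpha.
  by have /andP[? ?] := r_range n; apply/andP; split; lra.
have Cy n i : C (y n i) by case: (y_def n i).
pose yb n := y n (i_ n); pose zb n := z n (j_ n).
have FP v : F v -> [/\ C v, forall i, GEP dot C (f i) (A i) v &
    forall j, fixed_points C (S j) v].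
  rewrite F_def => -[GEPv Sv].
  have GEPv' i : GEP dot C (f i) (A i) v by exact: GEPv.
  by split=> [||j]; [case: (GEPv' (i_ 0%N))|exact: GEPv'|exact: Sv].
have y_step n i v : F v -> C (x n) -> (2 * alpha - e) * `|y n i - x n| ^+ 2 <=
    4 * alpha * (`|x n - v| ^+ 2 - `|y n i - v| ^+ 2).
  move=> /FP[_ GEPv _] Cx.
  apply: le_trans (resolvent_step dotE (f_equil i) (A_ism i) (r02 n) Cx (GEPv i)
    (y_def n i)).
  apply: ler_wpM2r; first exact: exprn_ge0.
  by have /andP[_ ?] := r_range n; lra.
have y_le n i v : F v -> C (x n) -> `|y n i - v| ^+ 2 <= `|x n - v| ^+ 2.
  move=> Fv Cx; have := y_step n i v Fv Cx.
  have /le_trans h : 0 <= (2 * alpha - e) * `|y n i - x n| ^+ 2.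
    by rewrite mulr_ge0 ?exprn_ge0// ltW.
  by move=> /h; rewrite pmulr_rge0 ?subr_ge0// mulr_gt0.
have z_step n j v : F v -> C (x n) -> `|z n j - v| ^+ 2 +
    (1 - al n) * (`|x n - v| ^+ 2 - `|yb n - v| ^+ 2) <= k n * `|x n - v| ^+ 2.
  move=> Fv Cx; rewrite z_def; have [_ _ Sv] := FP _ Fv.
  exact: (asp_mann_step dotE kappa_ge0 k_ge1 (S_asp j) n (al01 n) (be01 n)
    (Cy n (i_ n)) (Sv j) (y_le n (i_ n) v Fv Cx)).
have Cs_sub n : Cs n.+1 `<=` Cs n by rewrite CsS => v [].
have Cs_C n : Cs n `<=` C.
  by elim: n => [|n IH]; [rewrite Cs0|exact: subset_trans (Cs_sub n) IH].
have xE n : x n = metric_proj (Cs n) (x 0%N).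
  case: n => [|n]; last exact: xS.
  rewrite Cs0; apply/esym/(metric_proj_eq (p := x 0%N)) => // q _.
  by rewrite subrr normr0 expr0n subr0.
have x_Cs n : closed (Cs n) -> convex_set (Cs n) -> F `<=` Cs n -> Cs n (x n).
  move=> closedC convexC FC; rewrite xE.
  apply: (metric_projP dotE _ _ closedC convexC).1.
  by case: F_nonempty => v /FC; exists v.
have Cs_inv n : [/\ closed (Cs n), convex_set (Cs n) & F `<=` Cs n].
  elim: n => [|n [closedC convexC FC]].
    by rewrite Cs0; split=> // v /FP[].
  have Cx : C (x n) by apply/(Cs_C n)/x_Cs.
  rewrite CsS; split.
  - exact: (closedI closedC (@closed_bisector _ _ (x n) (z n (j_ n)) _)).
  - move=> u w t; rewrite !inE => -[Cu hu] [Cw hw]; split.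
      by have := convexC u w t; rewrite !inE; apply.
    have := convex_bisector dotE (c := (k n - 1) * (`|x n| + omega) ^+ 2)
      (x := x n) (z := z n (j_ n)).
    by move=> /(_ u w t); rewrite !inE; apply.
  - move=> v Fv; split; first exact: FC.
    apply: le_trans (_ : k n * `|x n - v| ^+ 2 <= _).
      apply: le_trans (z_step n (j_ n) v Fv Cx); rewrite lerDl.
      have /andP[_ ?] := al01 n.
      by rewrite mulr_ge0 ?subr_ge0//; exact: y_le.
    rewrite -lerBlDl -{2}[`|x n - v| ^+ 2]mul1r -mulrBl.
    apply: ler_wpM2l; first by rewrite subr_ge0.
    rewrite ler_sqr ?nnegrE//; last by rewrite addr_ge0// ltW.
    by apply: le_trans (ler_normB _ _) _; rewrite lerD2l; exact: omega_bound.
have closedCs n : closed (Cs n) by case: (Cs_inv n).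
have convexCs n : convex_set (Cs n) by case: (Cs_inv n).
have FCs n : F `<=` Cs n by case: (Cs_inv n).
have [p [xp p_near]] :=
  nested_projections_cvg dotE closedCs convexCs Cs_sub F_nonempty FCs xE.
have CxS n : Cs n (x n) by exact: x_Cs.
have Cx n : C (x n) by exact: Cs_C (CxS n).
have Cp : C p.
  by apply: (@closed_cvg _ _ \oo _ x C C_closed _ _ xp); exact: nearW.
have xSp : (fun n => x n.+1) @ \oo --> p by rewrite (cvg_shiftS x).
have zbp : zb @ \oo --> p.
  apply: (@cvg_sqr_dist_bound _ _ _ (fun n => x n.+1) _
    (fun n => `|x n - x n.+1| ^+ 2 + (k n - 1) * (`|x n| + omega) ^+ 2)) => //.
    rewrite -[0]addr0; apply: cvgD.
      rewrite -[0](expr0n _ 2) -(normr0 H) -(subrr p).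
      exact: cvg_sqr_dist.
    rewrite -(mul0r ((`|p| + omega) ^+ 2)) -(subrr 1).
    apply: cvgM; first by apply: cvgB => //; exact: cvg_cst.
    have norm_om : (fun n => `|x n| + omega) @ \oo --> `|p| + omega.
      by apply: cvgD; [exact: cvg_norm|exact: cvg_cst].
    exact: (cvgM norm_om norm_om).
  by apply: nearW => n; have := CxS n.+1; rewrite CsS => -[].
have zp j : (fun n => z n j) @ \oo --> p.
  apply: (@cvg_dist_bound _ _ _ x _ (fun n => `|zb n - x n|)) => //.
    exact: (cvg_dist0 (p := p)).
  by apply: nearW => n; exact: j_argmax.
have [a a1 al_a] := limn_esup_lt al_limsup.
have ybp : yb @ \oo --> p.
  (* The squared distances of x n and zb n to v to the same limit
     and k n tends to 1, so the loss in z_step vanishes; K collects the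
     constants of y_step and the lower bound 1 - a of the weight 1 - al n. *)
  have [v Fv] := F_nonempty.
  pose K := 4 * alpha / ((2 * alpha - e) * (1 - a)).
  apply: (@cvg_sqr_dist_bound _ _ _ x _
    (fun n => K * (k n * `|x n - v| ^+ 2 - `|zb n - v| ^+ 2))) => //.
    rewrite -(mulr0 K); apply: cvgM; first exact: cvg_cst.
    rewrite -(subrr (`|p - v| ^+ 2)) -{1}[`|p - v| ^+ 2]mul1r.
    apply: cvgB; [apply: cvgM => //|]; apply: cvg_sqr_dist => //;
      exact: cvg_cst.
  apply: filterS al_a => n al_a.
  have zn := z_step n (j_ n) v Fv (Cx n).
  have yn := y_step n (i_ n) v Fv (Cx n); have yxn := y_le n (i_ n) v Fv (Cx n).
  have ca : 0 < (2 * alpha - e) * (1 - a) by rewrite mulr_gt0// subr_gt0.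
  rewrite /K mulrAC ler_pdivlMr// mulrC.
  rewrite [_ * (1 - a)]mulrC -mulrA.
  apply: le_trans (ler_wpM2l _ yn) _; first lra.
  rewrite mulrCA; apply: ler_wpM2l; first lra.
  apply: (@le_trans _ _ ((1 - al n) * (`|x n - v| ^+ 2 - `|yb n - v| ^+ 2))).
    by apply: ler_wpM2r; [rewrite subr_ge0|lra].
  by rewrite -/(zb n) in zn; lra.
have yp i : (fun n => y n i) @ \oo --> p.
  apply: (@cvg_dist_bound _ _ _ x _ (fun n => `|yb n - x n|)) => //.
    exact: (cvg_dist0 (p := p)).
  by apply: nearW => n; exact: i_argmax.
have Sp j : S j p = p.
  apply: (asp_fixed_limit kappa_ge0 kappa_lt1 k_ge1 k_cvg (S_asp j)
    (u := yb)) => //.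
    by move=> n; exact: Cy.
  pose K := ((1 - a) * (1 - b))^-1.
  apply: (@cvg_dist_bound _ _ _ x _
    (fun n => K * (`|z n j - x n| + `|yb n - x n|))) => //.
    rewrite -(mulr0 K) -[X in K * X](addr0 0).
    apply: cvgM; first exact: cvg_cst.
    by apply: cvgD; exact: (cvg_dist0 (p := p)).
  apply: filterS al_a => n al_a.
  have /andP[al0 al1] := al_range n; have /andP[be0 beb] := be_range n.
  have ab : 0 < (1 - a) * (1 - b) by rewrite mulr_gt0// subr_gt0.
  rewrite /K mulrC ler_pdivlMr// mulrC.
  apply: (@le_trans _ _ ((1 - al n) * (1 - be n) *
      `|iter n (S j) (yb n) - x n|)).
    by apply: ler_wpM2r => //; apply: ler_pM; lra.
  have -> : (1 - al n) * (1 - be n) * `|iter n (S j) (yb n) - x n| =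
      `|(z n j - x n) - ((1 - al n) * be n) *: (yb n - x n)|.
    by rewrite z_def mann_displacement normrZ ger0_norm// mulr_ge0; lra.
  apply: le_trans (ler_normB _ _) _; rewrite lerD2l normrZ ger0_norm.
    rewrite -[leRHS]mul1r; apply: ler_wpM2r => //.
    rewrite -[leRHS]mul1r; apply: ler_pM; lra.
  by apply: mulr_ge0; lra.
have Fp : F p.
  rewrite F_def; split=> [i|j] _; last by split.
  apply: (resolvent_limit dotE (d := d) C_closed C_convex (f_equil i) alpha_gt0
    (A_ism i) _ _ Cx (fun n => y_def n i) xp (yp i)) => // n.
  by case/andP: (r_range n).
by rewrite (metric_proj_eq Fp p_near); split.
Qed.
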